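(* Let $(M_1,\Delta_1),\ldots,(M_h,\Delta_h)$ be homogeneous Garside monoids, all distinct from $M(1,1)$, and let $M=M_1*_\Delta\cdots*_\Delta M_h$ be their $\Delta$-product. Let $p,q$ be nonzero integers, and let $\rho\in G(M)$ be a $(p,q)$-periodic element. There is some $i\in \{1,\ldots,h\}$ and some $(p,q)$-periodic element $\sigma\in G(M_i)$ such that $\rho$ is conjugate to $\varphi_i(\sigma)$ in $G(M)$.
   Context: A monoid $M$ is homogeneous if there is a monoid morphism $M\to(\mathbb{Z}_{\geq 0},+)$ such that the elements of positive image generate $M$. Let $M$ be homogeneous and cancellative. Write $a\preceq b$ if $b=ac$ for some $c\in M$ (left-divisibility) and $b\succeq a$ if $b=ca$ for some $c\in M$ (right-divisibility). $(M,\Delta)$ is a homogeneous Garside monoid if $(M,\preceq)$ and $(M,\succeq)$ are lattices and $\Delta\in M$ has equal sets of left- and right-divisors, this set being finite and generating $M$. $M$ embeds in its enveloping group $G(M)$. For a homogeneous Garside monoid $(M,\Delta)$, an element $\rho\in G(M)$ is $(p,q)$-periodic if $\rho^p=\Delta^q$ (for $G(M_i)$, $\Delta$ is replaced with $\Delta_i$). The $\Delta$-product $M=M_1*_\Delta\cdots*_\Delta M_h$ ($h\geq 1$) is the quotient of the free product of monoids $M_1*\cdots*M_h$ by the relations $\Delta_i=\Delta_j$ for all $i,j$. Let $\Delta\in M$ be the common image of the $\Delta_i$. It is known that $(M,\Delta)$ is a homogeneous Garside monoid. The natural group morphism $G(M_i)\to G(M)$ is denoted by $\varphi_i$. $M(1,1)$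 denotes the monoid $\mathbb{Z}_{\geq 0}$ with Garside element its generator; ''distinct from $M(1,1)$'' means that $(M_i,\Delta_i)$ is not isomorphic to it as a monoid with distinguished Garside element.
   Formalization: It is additionally assumed that if one Δ_i equals 1 (i.e. M_i is the trivial monoid) then all do; mixing trivial and nontrivial factors makes the Δ-product fail to be a homogeneous Garside monoid and the claim can then fail. *)

(* Defs.v *)
From HB Require Import structures.
From mathcomp Require Import all_boot ssralg ssrint.
From mathcomp Require Import boolp classical_sets cardinality.

Set Implicit Arguments.
Unset Strict Implicit.
Unset Printing Implicit Defensive.

Local Open Scope quotient_scope.
Local Open Scope group_scope.
Local Open Scope classical_set_scope.

Section Garside.
Variable M : monoidType.
Implicit Types (a b x y : M) (S : set M).

Definition generates S : Prop :=
  forall x, exists2 s : seq M, (forall y, y \in s -> S y) & x = \prod_(y <- s) y.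

Definition nat_morphism (l : M -> nat) : Prop :=
  l 1 = 0%N /\ {morph l : x y / x * y >-> (x + y)%N}.

Definition homogeneous : Prop :=
  exists2 l : M -> nat, nat_morphism l & generates [set x | (0 < l x)%N].

Definition cancellative : Prop :=
  (forall a, injective (fun x => a * x)) /\ (forall a, injective (fun x => x * a)).

Definition preceq a b : Prop := exists c, b = a * c.

Definition succeq b a : Prop := exists c, b = c * a.

(* (M, Delta) is isomorphic to M(1,1), i.e. to (nat, +) with its generator 1. *)
Definition M11 (Delta : M) : Prop :=
  exists l : M -> nat, [/\ nat_morphism l, bijective l & l Delta = 1%N].

End Garside.

Definition lattice_relation (T : Type) (R : T -> T -> Prop) : Prop :=
  [/\ forall x, R x x,
      forall x y, R x y -> R y x -> x = y,
      forall x y z, R x y -> R y z -> R x z,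
      forall x y, exists m, forall z, R z m <-> R z x /\ R z y
    & forall x y, exists j, forall z, R j z <-> R x z /\ R y z].

Record homogeneous_garside (M : monoidType) (Delta : M) : Prop :=
  HomogeneousGarside {
    garside_homogeneous : homogeneous M;
    garside_cancellative : cancellative M;
    garside_left_lattice : lattice_relation (@preceq M);
    garside_right_lattice : lattice_relation (@succeq M);
    garside_divisors : [set a | preceq a Delta] = [set a | succeq Delta a];
    garside_finite : finite_set [set a | preceq a Delta];
    garside_generates : generates [set a | preceq a Delta] }.

Section MonoidQuotient.
Variables (M : monoidType) (R : M -> M -> Prop).

Inductive cong : M -> M -> Prop :=
| cong_rel x y : R x y -> cong x y
| cong_refl x : cong x x
| cong_sym x y : cong x y -> cong y x
| cong_trans x y z : cong x y -> cong y z -> cong x z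
| cong_mul x x' y y' : cong x x' -> cong y y' -> cong (x * y) (x' * y').

Definition congb (x y : M) : bool := `[<cong x y>].

Lemma congb_refl : reflexive congb.
Proof. by move=> x; apply/asboolP; exact: cong_refl. Qed.

Lemma congb_sym : symmetric congb.
Proof. by move=> x y; apply/asboolP/asboolP; exact: cong_sym. Qed.

Lemma congb_trans : transitive congb.
Proof.
by move=> y x z /asboolP xy /asboolP yz; apply/asboolP; exact: cong_trans yz.
Qed.

Canonical cong_equiv := EquivRel congb congb_refl congb_sym congb_trans.

Definition mquot := {eq_quot cong_equiv}.
HB.instance Definition _ := Choice.on mquot.
HB.instance Definition _ := Quotient.on mquot.

Definition mquot_in (x : M) : mquot := \pi_mquot x.

Definition mquot_mul (a b : mquot) : mquot := mquot_in (repr a * repr b).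

Lemma mquot_inP x y : mquot_in x = mquot_in y <-> cong x y.
Proof.
split=> [/eqmodP/asboolP //|xy]; apply/eqmodP; exact/asboolP.
Qed.

Lemma mquot_reprK (a : mquot) : mquot_in (repr a) = a.
Proof. exact: reprK. Qed.

Lemma mquot_mulE x y : mquot_mul (mquot_in x) (mquot_in y) = mquot_in (x * y).
Proof. by apply/mquot_inP; apply: cong_mul; apply/mquot_inP; exact: mquot_reprK. Qed.

Lemma mquot_mulA : associative mquot_mul.
Proof.
move=> a b c; rewrite -(mquot_reprK a) -(mquot_reprK b) -(mquot_reprK c).
by rewrite !mquot_mulE mulgA.
Qed.

Lemma mquot_mul1 : left_id (mquot_in 1) mquot_mul.
Proof. by move=> a; rewrite -(mquot_reprK a) mquot_mulE mul1g. Qed.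

Lemma mquot_mulr1 : right_id (mquot_in 1) mquot_mul.
Proof. by move=> a; rewrite -(mquot_reprK a) mquot_mulE mulg1. Qed.

HB.instance Definition _ :=
  isMonoid.Build mquot mquot_mulA mquot_mul1 mquot_mulr1.

Lemma mquot_inM : {morph mquot_in : x y / x * y}.
Proof. by move=> x y; rewrite -mquot_mulE. Qed.

HB.instance Definition _ := isMultiplicative.Build M mquot mquot_in mquot_inM.
HB.instance Definition _ :=
  Multiplicative_isUMagmaMorphism.Build M mquot mquot_in erefl.

Lemma mquot_rel x y : R x y -> mquot_in x = mquot_in y.
Proof. by move=> xy; apply/mquot_inP; exact: cong_rel. Qed.

Lemma cong_morph (N : monoidType) (f : M -> N) :
  {morph f : x y / x * y} -> (forall x y, R x y -> f x = f y) ->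
  forall x y, cong x y -> f x = f y.
Proof.
move=> fM fR x y; elim=> // [{}x {}y z _ -> _ //|u u' v v' _ fu _ fv].
by rewrite !fM fu fv.
Qed.

End MonoidQuotient.

Definition freeMonoid (A : choiceType) := seq A.
HB.instance Definition _ (A : choiceType) := Choice.on (freeMonoid A).
HB.instance Definition _ (A : choiceType) :=
  isMonoid.Build (freeMonoid A) (@catA A) (@cat0s A) (@cats0 A).

Definition letter (A : choiceType) (x : A) : freeMonoid A := [:: x].

Section DeltaProduct.
Variables (h : nat) (M : 'I_h -> monoidType) (Delta : forall i, M i).

Definition factors : choiceType := {i : 'I_h & M i}.
Definition factor_in (i : 'I_h) (x : M i) : freeMonoid factors :=
  letter (existT (fun i => M i : Type) i x : factors).

Inductive freeProd_rel : freeMonoid factors -> freeMonoid factors -> Prop :=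
| freeProd_one i : freeProd_rel (@factor_in i 1) 1
| freeProd_mul i (x y : M i) :
    freeProd_rel (factor_in (x * y)) (factor_in x * factor_in y).

Definition freeProd : monoidType := mquot freeProd_rel.

Definition freeProd_in (i : 'I_h) (x : M i) : freeProd :=
  mquot_in freeProd_rel (factor_in x).

Inductive deltaProd_rel : freeProd -> freeProd -> Prop :=
| deltaProd_eq i j :
    deltaProd_rel (freeProd_in (Delta i)) (freeProd_in (Delta j)).

Definition deltaProd : monoidType := mquot deltaProd_rel.

Definition deltaProd_in (i : 'I_h) (x : M i) : deltaProd :=
  mquot_in deltaProd_rel (freeProd_in x).

Lemma deltaProd_inM i : {morph @deltaProd_in i : x y / x * y}.
Proof.
move=> x y; rewrite /deltaProd_in -mquot_inM; congr mquot_in.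
by rewrite /freeProd_in -mquot_inM; apply: mquot_rel; exact: freeProd_mul.
Qed.

Lemma deltaProd_in1 i : @deltaProd_in i 1 = 1.
Proof.
congr (mquot_in _ _); apply: mquot_rel; exact: freeProd_one.
Qed.

HB.instance Definition _ i :=
  isMultiplicative.Build (M i) deltaProd (@deltaProd_in i) (@deltaProd_inM i).
HB.instance Definition _ i :=
  Multiplicative_isUMagmaMorphism.Build (M i) deltaProd (@deltaProd_in i)
    (@deltaProd_in1 i).

(* If some Delta i is 1 (so that M i is trivial), the relations also impose
   Delta j = 1 for every j; when some M j is nontrivial, deltaProd need then not
   be a Garside monoid: it is a group, possibly nontrivial. *)
Definition deltaProd_Delta (h_gt0 : (0 < h)%N) : deltaProd :=
  deltaProd_in (Delta (Ordinal h_gt0)).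

Lemma deltaProd_DeltaE (h_gt0 : (0 < h)%N) i :
  deltaProd_in (Delta i) = deltaProd_Delta h_gt0.
Proof. exact/mquot_rel/deltaProd_eq. Qed.

End DeltaProduct.

(* The enveloping group is presented, as a monoid, by the generators inl x
   (the image of x) and inr x (its inverse), for x in M. *)
Section EnvelopingGroup.
Variable M : monoidType.

Definition env_letter : choiceType := (M + M)%type.
Definition env_pos (x : M) : freeMonoid env_letter := letter (inl x : env_letter).
Definition env_neg (x : M) : freeMonoid env_letter := letter (inr x : env_letter).

Inductive env_rel : freeMonoid env_letter -> freeMonoid env_letter -> Prop :=
| env_one : env_rel (env_pos 1) 1
| env_mul x y : env_rel (env_pos (x * y)) (env_pos x * env_pos y)
| env_mulV x : env_rel (env_pos x * env_neg x) 1
| env_Vmul x : env_rel (env_neg x * env_pos x) 1.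

Definition envGroup := mquot env_rel.
HB.instance Definition _ := Monoid.on envGroup.

Definition env_flip (a : env_letter) : env_letter :=
  match a with inl x => inr x | inr x => inl x end.

Definition env_inv (a : envGroup) : envGroup :=
  mquot_in env_rel (rev (map env_flip (repr a)) : freeMonoid env_letter).

Lemma env_flipK (a : env_letter) :
  mquot_in env_rel (letter a * letter (env_flip a)) = 1 /\
  mquot_in env_rel (letter (env_flip a) * letter a) = 1.
Proof.
by case: a => x; split; apply: mquot_rel; do ?[exact: env_mulV|exact: env_Vmul].
Qed.

Lemma env_word_inv (w : freeMonoid env_letter) :
  let v := rev (map env_flip w) : freeMonoid env_letter in
  mquot_in env_rel (v * w) = 1 /\ mquot_in env_rel (w * v) = 1.
Proof.
elim: w => [//|a w]; set v := rev _ => -[IHl IHr] /=.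
rewrite rev_cons -cats1 -/v.
change (mquot_in env_rel (((v : freeMonoid env_letter) * letter (env_flip a)) * (letter a * (w : freeMonoid env_letter))) = 1 /\
  mquot_in env_rel ((letter a * (w : freeMonoid env_letter)) * ((v : freeMonoid env_letter) * letter (env_flip a))) = 1).
have [flr frl] := env_flipK a.
split.
  rewrite -mulgA (mulgA (letter (env_flip a))) mquot_inM.
  by rewrite (mquot_inM _ (_ * _)) frl mul1g -mquot_inM.
rewrite -mulgA (mulgA (w : freeMonoid env_letter)) mquot_inM.
by rewrite (mquot_inM _ (_ * _)) IHr mul1g -mquot_inM.
Qed.

Lemma env_mulVg : left_inverse 1 env_inv (@mul envGroup).
Proof.
move=> a; rewrite -{2}(mquot_reprK a) -mquot_inM.
exact: (proj1 (env_word_inv (repr a))).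
Qed.

Lemma env_mulgV : right_inverse 1 env_inv (@mul envGroup).
Proof.
move=> a; rewrite -{1}(mquot_reprK a) -mquot_inM.
exact: (proj2 (env_word_inv (repr a))).
Qed.

HB.instance Definition _ := hasInv.Build envGroup env_inv.
HB.instance Definition _ := Monoid_isGroup.Build envGroup env_mulVg env_mulgV.

Definition env_in (x : M) : envGroup := mquot_in env_rel (env_pos x).

Lemma env_inM : {morph env_in : x y / x * y}.
Proof.
by move=> x y; rewrite /env_in -mquot_inM; apply: mquot_rel; exact: env_mul.
Qed.

Lemma env_in1 : env_in 1 = 1.
Proof. by apply: mquot_rel; exact: env_one. Qed.

HB.instance Definition _ := isMultiplicative.Build M envGroup env_in env_inM.
HB.instance Definition _ :=
  Multiplicative_isUMagmaMorphism.Build M envGroup env_in env_in1.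

End EnvelopingGroup.

Section EnvelopingMorphism.
Variables (M : monoidType) (G : groupType) (f : UMagmaMorphism.type M G).

Definition env_eval_letter (a : env_letter M) : G :=
  match a with inl x => f x | inr x => (f x)^-1 end.

Definition env_eval (w : freeMonoid (env_letter M)) : G :=
  \prod_(a <- w) env_eval_letter a.

Lemma env_evalM : {morph env_eval : u v / u * v}.
Proof. by move=> u v; rewrite /env_eval big_cat. Qed.

Lemma env_eval1 (a : env_letter M) : env_eval (letter a) = env_eval_letter a.
Proof. by rewrite /env_eval big_seq1. Qed.

Lemma env_eval_cong u v : cong (@env_rel M) u v -> env_eval u = env_eval v.
Proof.
apply: cong_morph; first exact: env_evalM.
move=> _ _ [|x y|x|x]; rewrite ?env_evalM !env_eval1 /= ?[env_eval 1]big_nil.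
- exact: gmulf1.
- exact: gmulfM.
- exact: mulgV.
- exact: mulVg.
Qed.

Definition env_lift (a : envGroup M) : G := env_eval (repr a).

Lemma env_lift_in u : env_lift (mquot_in (@env_rel M) u) = env_eval u.
Proof. by apply: env_eval_cong; apply/mquot_inP; exact: mquot_reprK. Qed.

Lemma env_liftE x : env_lift (env_in x) = f x.
Proof. by rewrite env_lift_in env_eval1. Qed.

Lemma env_liftM : {morph env_lift : a b / a * b}.
Proof.
move=> a b; rewrite -(mquot_reprK a) -(mquot_reprK b) -mquot_inM !env_lift_in.
exact: env_evalM.
Qed.

HB.instance Definition _ :=
  isMultiplicative.Build (envGroup M) G env_lift env_liftM.

Lemma env_lift1 : env_lift 1 = 1.
Proof. by rewrite -[1]/(mquot_in _ 1) env_lift_in /env_eval big_nil. Qed.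

HB.instance Definition _ :=
  Multiplicative_isUMagmaMorphism.Build (envGroup M) G env_lift env_lift1.

End EnvelopingMorphism.

Definition phi (h : nat) (M : 'I_h -> monoidType) (Delta : forall i, M i)
    (i : 'I_h) : envGroup (M i) -> envGroup (deltaProd Delta) :=
  env_lift (@env_in (deltaProd Delta) \o @deltaProd_in h M Delta i).

HB.instance Definition _ (h : nat) (M : 'I_h -> monoidType)
    (Delta : forall i, M i) (i : 'I_h) :=
  UMagmaMorphism.copy (@phi h M Delta i)
    (env_lift (@env_in (deltaProd Delta) \o @deltaProd_in h M Delta i)).

Lemma phiE (h : nat) (M : 'I_h -> monoidType) (Delta : forall i, M i)
    (i : 'I_h) (x : M i) :
  phi Delta (env_in x) = env_in (deltaProd_in Delta x).
Proof. exact: env_liftE. Qed.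

Definition expgz (G : groupType) (x : G) (n : int) : G :=
  match n with Posz m => x ^+ m | Negz m => x ^- m.+1 end.

Definition periodic (M : monoidType) (Delta : M) (p q : int) (rho : envGroup M)
  : Prop := expgz rho p = expgz (env_in Delta) q.

Definition conjugate (G : groupType) (x y : G) : Prop := exists g : G, x = y ^ g.

(* Main.v *)
Require Import Defs.
From HB Require Import structures.
From mathcomp Require Import all_boot ssralg ssrint.
From mathcomp Require Import boolp classical_sets.

(** Unless Delta = 1, in which case all groups are trivial, the enveloping group
    of the Delta-product is the amalgamated product K of the enveloping groups
    G_i along the infinite cyclic group A generated by Delta. Homogeneity
    provides each G_i with a morphism to the integers that is positive on
    Delta, so two powers of Delta that are conjugate in G_i have equal
    exponents. The result is then an instance of a fact about amalgamated
    products (amalgam_root_conjugate): if elements a, b of A with a g = g b in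
    some G_i are always equal, then a root in K of an element of A is conjugate
    to a root of the same element in some G_i.

    To see this, let k ^ p = a, where p > 0 after inverting if necessary.
    Write k as a reduced word g_1 ... g_n: no letter in A, neighbours in
    distinct factors. Since k commutes with its power a, the words
    (a g_1) g_2 ... g_n and g_1 ... g_n a have the same value; comparing normal
    forms gives a g_1 b = g_1 c with b, c in A, so that a commutes with g_1
    (commute_head). If n > 1 and g_1, g_n lie in distinct factors, then the
    concatenation of p copies of the word is reduced, so k ^ p is not in A.
    If n > 1 and g_1, g_n lie in the same factor, conjugation by g_1 fixes a
    and turns k into the shorter word g_2 ... (g_n g_1), and induction applies
    (conj_into_factor). If n <= 1, then k comes from a factor, and the equation
    k ^ p = a holds there because the factors embed in K.

    Reduced words are controlled by the action of K on normal forms, after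
    van der Waerden (translate, act_reduced). The action is obtained from the
    universal property of K, which the presentations of the Delta-product and
    of its enveloping group provide (deltaProd_env_universal). *)

Set Implicit Arguments.
Unset Strict Implicit.
Unset Printing Implicit Defensive.

Local Open Scope group_scope.

(** * Normal forms in an amalgamated product *)

Section NormalForms.
Variables (I : choiceType) (A : groupType) (G : I -> groupType).
Variable iota : forall i, UMagmaMorphism.type A (G i).
Hypothesis iota_inj : forall i, injective (iota i).

Notation letters := {i : I & G i}.
Notation Letter i g := (existT (fun j => G j : Type) i g : letters).

Definition amalgamated i (g : G i) : bool := `[<exists a, g = iota i a>].

(** A transversal of the right cosets of A in G_i. The coset A itself is
    represented by 1, so that a letter is trivial exactly when it lies in A;
    on the other cosets, the value of choose depends on the coset only. *)
Definition coset_rep i (g : G i) : G i :=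
  if amalgamated g then 1
  else choose (fun h => `[<exists a, h = iota i a * g>]) g.

Lemma amalgamated_iota i a : amalgamated (iota i a).
Proof. by apply/asboolP; exists a. Qed.

Lemma amalgamated1 i : amalgamated (1 : G i).
Proof. by apply/asboolP; exists 1; rewrite gmulf1. Qed.

Lemma amalgamatedMl i a (g : G i) : amalgamated (iota i a * g) = amalgamated g.
Proof.
apply/asboolP/asboolP => -[b gb]; last by exists (a * b); rewrite gb gmulfM.
by exists (a^-1 * b); rewrite gmulfM gmulfV -gb mulKg.
Qed.

Lemma amalgamatedMr i a (g : G i) : amalgamated (g * iota i a) = amalgamated g.
Proof.
apply/asboolP/asboolP => -[b gb]; last by exists (b * a); rewrite gb gmulfM.
by exists (b * a^-1); rewrite gmulfM gmulfV -gb mulgK.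
Qed.

Lemma coset_repP i (g : G i) : exists a, g = iota i a * coset_rep g.
Proof.
rewrite /coset_rep; case: ifP => [/asboolP[a ->]|_].
  by exists a; rewrite mulg1.
set P := fun h => `[<_>].
have /asboolP[a ha] : P (choose P g).
  by apply: chooseP; apply/asboolP; exists 1; rewrite gmulf1 mul1g.
by exists a^-1; rewrite ha gmulfV mulKg.
Qed.

Lemma coset_repMl i a (g : G i) : coset_rep (iota i a * g) = coset_rep g.
Proof.
rewrite /coset_rep amalgamatedMl; case: ifP => // _.
set P := fun h => `[<_>]; set Q := fun h => `[<_>].
have PQ : P =1 Q.
  move=> h; apply/asboolP/asboolP => -[b ->].
    by exists (b * a); rewrite gmulfM mulgA.
  by exists (b * a^-1); rewrite gmulfM gmulfV mulgA mulgVK.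
rewrite (eq_choose PQ); apply: choose_id; apply/asboolP; first by exists a.
by exists 1; rewrite gmulf1 mul1g.
Qed.

Lemma coset_rep_id i (g : G i) : coset_rep (coset_rep g) = coset_rep g.
Proof. by have [a {2}->] := coset_repP g; rewrite coset_repMl. Qed.

Lemma coset_rep_eq1 i (g : G i) : (coset_rep g == 1) = amalgamated g.
Proof.
apply/eqP/idP => [g1|]; last by rewrite /coset_rep => ->.
by have [a ->] := coset_repP g; rewrite g1 mulg1 amalgamated_iota.
Qed.

Definition coset_coef i (g : G i) : A := sval (cid (coset_repP g)).

Lemma coset_coefE i (g : G i) : iota i (coset_coef g) * coset_rep g = g.
Proof. by rewrite /coset_coef; case: cid. Qed.

Lemma coset_coefMl i a (g : G i) : coset_coef (iota i a * g) = a * coset_coef g.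
Proof.
apply: (@iota_inj i); apply: (mulIg (coset_rep g)).
by rewrite -{1}(coset_repMl a) coset_coefE gmulfM -mulgA coset_coefE.
Qed.

Lemma coset_coef_rep i (g : G i) : coset_coef (coset_rep g) = 1.
Proof.
apply: (mulgI (coset_coef g)).
by rewrite -coset_coefMl coset_coefE mulg1.
Qed.

Lemma coset_coef1 i : coset_coef (1 : G i) = 1.
Proof.
have /eqP <- : coset_rep (1 : G i) == 1 by rewrite coset_rep_eq1 amalgamated1.
exact: coset_coef_rep.
Qed.

Definition alternating (w : seq letters) :=
  sorted (fun i j => i != j) (map tag w).

Definition normal_letter (u : letters) :=
  (coset_rep (tagged u) == tagged u) && (tagged u != 1).

Definition normal_word w := alternating w && all normal_letter w.

(** Unlike those of a normal word, the letters of a reduced word need not be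
    coset representatives, which makes this notion stable under multiplying
    a letter by an element of A. *)
Definition reduced w :=
  alternating w && all (fun u => ~~ amalgamated (tagged u)) w.

Definition avoids i (w : seq letters) := ohead (map tag w) != Some i.

Lemma normal_letterE u :
  normal_letter u ->
  coset_rep (tagged u) = tagged u /\ ~~ amalgamated (tagged u).
Proof. by case/andP => /eqP ue u1; rewrite -coset_rep_eq1 ue. Qed.

Lemma normal_reduced w : normal_word w -> reduced w.
Proof.
case/andP => walt wn; apply/andP; split=> //.
by apply: sub_all wn => u /normal_letterE[].
Qed.

Lemma alternating_cons u w :
  alternating (u :: w) = avoids (tag u) w && alternating w.
Proof. by case: w => [//|v w]; rewrite /alternating /avoids /= eq_sym. Qed.

Lemma normal_cons u w :
  normal_word (u :: w) = [&& avoids (tag u) w, normal_letter u & normal_word w].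
Proof.
rewrite /normal_word alternating_cons /= -!andbA.
by rewrite [alternating w && _]andbCA [alternating w && _]andbCA.
Qed.

(** A pair (a, w) stands for the normal form a w. For each i, splitting off
    the first letter of w when it lies in G_i, and 1 otherwise, identifies the
    normal forms with the pairs of an element of G_i and a normal word that
    avoids i. The default value of tagged_as gives 1 when the first letter
    lies in another factor. *)
Definition head_in i (w : seq letters) : G i :=
  if w is u :: _ then tagged_as (Letter i 1) u else 1.

Definition tail_in i (w : seq letters) : seq letters :=
  if w is u :: w' then if tag u == i then w' else w else w.

Definition split_in i (x : A * seq letters) : G i * seq letters :=
  (iota i x.1 * head_in i x.2, tail_in i x.2).

Definition join_in i (y : G i * seq letters) : A * seq letters :=
  (coset_coef y.1,
   if amalgamated y.1 then y.2 else Letter i (coset_rep y.1) :: y.2).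

Lemma tagged_asN i j (g : G i) (h : G j) :
  j != i -> tagged_as (Letter i g) (Letter j h) = g.
Proof. by rewrite /tagged_as /= eq_sym; case: eqP. Qed.

Variant head_spec i w : G i -> seq letters -> Prop :=
| HeadIn g w' of w = Letter i g :: w' : head_spec w g w'
| HeadOut of avoids i w : head_spec w 1 w.

Lemma headP i w : head_spec w (head_in i w) (tail_in i w).
Proof.
case: w => [|[j g] w] /=; first by right.
have [ji|ji] := eqVneq j i; last by rewrite tagged_asN //; right.
by case: _ / ji in g *; rewrite tagged_asE; left.
Qed.

Lemma avoids_tail i w : normal_word w -> avoids i (tail_in i w).
Proof. by case: headP => // g w' ->; rewrite normal_cons => /and3P[]. Qed.

Lemma normal_tail i w : normal_word w -> normal_word (tail_in i w).
Proof. by case: headP => // g w' ->; rewrite normal_cons => /and3P[]. Qed.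

Lemma split_inK i x : normal_word x.2 -> join_in (split_in i x) = x.
Proof.
case: x => a w; rewrite /join_in /split_in /= => nw.
rewrite coset_coefMl coset_repMl amalgamatedMl.
case: headP nw => [g w' ->|_ _].
  rewrite normal_cons => /and3P[_ /normal_letterE[/= ge /negPf ->] _].
  by rewrite ge -{1}ge coset_coef_rep mulg1.
by rewrite amalgamated1 coset_coef1 mulg1.
Qed.

Lemma join_inK i y : avoids i y.2 -> split_in i (join_in y) = y.
Proof.
case: y => g w; rewrite /join_in /split_in /= => aw.
case: ifP => ga; last by rewrite /= eqxx tagged_asE coset_coefE.
have /eqP rg : coset_rep g == 1 by rewrite coset_rep_eq1.
have {2}<- := coset_coefE g; rewrite rg.
case: headP aw => [h w' ->|//].
by rewrite /avoids /= eqxx.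
Qed.

Lemma normal_join i (y : G i * seq letters) :
  avoids i y.2 -> normal_word y.2 -> normal_word (join_in y).2.
Proof.
case: y => g w aw nw; rewrite /join_in /=; case: ifP => // /negbT ga.
by rewrite normal_cons aw nw /normal_letter /= coset_rep_id eqxx coset_rep_eq1 ga.
Qed.

(** Under the identification of the normal forms with G_i times the words
    avoiding i, the group G_i acts by left multiplication on the first
    coordinate. Elements of A act on the first coordinate of (a, w), whatever
    i is, which is why these actions assemble into one of the amalgam. *)
Definition translate i (g : G i) x : A * seq letters :=
  let y := split_in i x in join_in (g * y.1, y.2).

Lemma normal_translate i (g : G i) x :
  normal_word x.2 -> normal_word (translate g x).2.
Proof.
move=> nx; apply: normal_join => /=; first exact: avoids_tail.
exact: normal_tail.
Qed.

Lemma translateM i (g h : G i) x : normal_word x.2 ->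
  translate (g * h) x = translate g (translate h x).
Proof.
move=> nx; rewrite /translate join_inK /= ?mulgA //.
exact: avoids_tail.
Qed.

Lemma translate_iota i a b w :
  normal_word w -> translate (iota i a) (b, w) = (a * b, w).
Proof.
move=> nw; rewrite /translate /= mulgA -gmulfM.
exact: (@split_inK i (a * b, w)).
Qed.

Lemma translate1 i x : normal_word x.2 -> translate (1 : G i) x = x.
Proof.
by case: x => a w nw; rewrite -[1](gmulf1 (s := iota i)) translate_iota // mul1g.
Qed.

Lemma translate_avoids i (g : G i) a w : avoids i w ->
  translate g (a, w) = join_in (g * iota i a, w).
Proof.
rewrite /translate /split_in /=; case: headP => [h w' ->|_ _].
  by rewrite /avoids /= eqxx.
by rewrite mulg1.
Qed.

Lemma size_translate i (g : G i) x : size (translate g x).2 <= (size x.2).+1.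
Proof.
have tail_le : size (tail_in i x.2) <= size x.2 by case: headP => // h w' ->.
by rewrite /translate /join_in /=; case: ifP => _ /=; rewrite ?ltnS // ltnW.
Qed.

Definition normal_form := {x : A * seq letters | normal_word x.2}.

Definition act_letter i (g : G i) (x : normal_form) : normal_form :=
  exist _ (translate g (val x)) (normal_translate g (valP x)).

Lemma act_letterM i (g h : G i) x :
  act_letter (g * h) x = act_letter g (act_letter h x).
Proof. by apply: val_inj; apply: translateM (valP x). Qed.

Lemma act_letter1 i x : act_letter (1 : G i) x = x.
Proof. by apply: val_inj; apply: translate1 (valP x). Qed.

Lemma act_letter_iota i j a x :
  act_letter (iota i a) x = act_letter (iota j a) x.
Proof.
by apply: val_inj; case: x => -[b w] nw; rewrite /= !translate_iota.
Qed.

Lemma join_in_inj i (y z : G i * seq letters) :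
  avoids i y.2 -> avoids i z.2 -> join_in y = join_in z -> y = z.
Proof. by move=> ay az /(congr1 (split_in i)); rewrite !join_inK. Qed.

(** * Roots of amalgamated elements *)

(** K is a group generated by the images of the factors, in which the copies of
    A agree, and which acts on the normal forms compatibly with translate. The
    existence of the action is what makes K the full amalgamated product. *)
Section Amalgam.
Variables (K : groupType) (emb : forall i, UMagmaMorphism.type (G i) K).
Variable embA : UMagmaMorphism.type A K.
Hypothesis emb_iota : forall i a, emb i (iota i a) = embA a.

Definition word_value (w : seq letters) : K :=
  \prod_(u <- w) emb (tag u) (tagged u).

Hypothesis generated : forall k, exists w, k = word_value w.

Variable act : K -> normal_form -> normal_form.
Hypothesis act1 : forall x, act 1 x = x.
Hypothesis actM : forall k l x, act (k * l) x = act k (act l x).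
Hypothesis act_emb : forall i (g : G i) x,
  val (act (emb i g) x) = translate g (val x).
Hypothesis act_embA : forall a x,
  val (act (embA a) x) = (a * (val x).1, (val x).2).

Definition base (a : A) : normal_form :=
  exist (fun x => is_true (normal_word x.2)) (a, [::]) isT.

Definition form_value (x : A * seq letters) : K := embA x.1 * word_value x.2.

Lemma word_value_cons u w :
  word_value (u :: w) = emb (tag u) (tagged u) * word_value w.
Proof. exact: big_cons. Qed.

Lemma word_value_rcons u w :
  word_value (rcons w u) = word_value w * emb (tag u) (tagged u).
Proof. by rewrite /word_value -cats1 big_cat big_seq1. Qed.

Lemma form_value_translate i (g : G i) x :
  form_value (translate g x) = emb i g * form_value x.
Proof.
have join_value y : form_value (join_in y) = emb i y.1 * word_value y.2.
  case: y => h w; rewrite /form_value /join_in /=.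
  rewrite -[h in RHS]coset_coefE gmulfM emb_iota -mulgA.
  case: ifP => [|_]; last by rewrite word_value_cons.
  by rewrite -coset_rep_eq1 => /eqP ->; rewrite gmulf1 mul1g.
rewrite join_value /= !gmulfM emb_iota -!mulgA; congr (_ * (_ * _)).
by case: headP => [h w ->|_]; rewrite ?word_value_cons // gmulf1 mul1g.
Qed.

(** Applied to the empty normal form, this shows that the normal form obtained
    by letting k act represents k. *)
Lemma form_value_act k x : form_value (val (act k x)) = k * form_value (val x).
Proof.
have [w ->] := generated k; elim: w => [|u w IHw].
  by rewrite /word_value big_nil act1 mul1g.
by rewrite word_value_cons actM act_emb form_value_translate IHw mulgA.
Qed.

Lemma emb_inj i : injective (emb i).
Proof.
move=> g h gh; have := congr1 (fun k => val (act k (base 1))) gh.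
rewrite !act_emb /= !translate_avoids // => /join_in_inj -/(_ isT isT) [].
by rewrite gmulf1 !mulg1.
Qed.

(** Each letter g of a reduced word adds exactly one letter to the normal form:
    it meets a word that avoids its factor, and g b is not in A for b in A. *)
Lemma act_reduced w x :
    all (fun u => ~~ amalgamated (tagged u)) w ->
    sorted (fun i j => i != j) (map tag w ++ map tag (val x).2) ->
  map tag (val (act (word_value w) x)).2 = map tag w ++ map tag (val x).2.
Proof.
elim: w => [|u w IHw] /= in x *; first by rewrite /word_value big_nil act1.
case/andP => u_n w_n uw_s.
have {}IHw := IHw x w_n (path_sorted uw_s).
rewrite word_value_cons actM act_emb.
case: (val (act (word_value w) x)) IHw => a v; rewrite -[(a, v).2]/v => tag_v.
rewrite translate_avoids /=; last first.
  move: uw_s; rewrite -tag_v /avoids; case: v {tag_v} => //= t v.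
  by case/andP; rewrite eq_sym.
by rewrite amalgamatedMr (negPf u_n) /= tag_v.
Qed.

Lemma size_act w x :
  size (val (act (word_value w) x)).2 <= size w + size (val x).2.
Proof.
elim: w => [|u w IHw]; first by rewrite /word_value big_nil act1.
rewrite word_value_cons actM act_emb addSn.
exact: leq_trans (size_translate _ _) _.
Qed.

(** Normal forms are no longer than the words they come from; when there are at
    least two letters, the prefix from A is absorbed by the first one. *)
Lemma reduce (i0 : I) w :
  (exists i (g : G i), word_value w = emb i g) \/
  exists w', [/\ word_value w' = word_value w, reduced w'
               & 1 < size w' <= size w].
Proof.
have := form_value_act (word_value w) (base 1).
have -> : form_value (val (base 1)) = 1.
  by rewrite /form_value /word_value big_nil gmulf1 mulg1.
rewrite mulg1.
have := size_act w (base 1); rewrite addn0.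
case: (act _ _) => -[a [|u [|v x]]] /= nx size_x <-; rewrite /form_value /=.
- by left; exists i0, (iota i0 a); rewrite /word_value big_nil mulg1 emb_iota.
- left; exists (tag u), (iota (tag u) a * tagged u).
  by rewrite /word_value big_seq1 gmulfM emb_iota.
right; exists (Letter (tag u) (iota (tag u) a * tagged u) :: v :: x); split=> //.
  by rewrite !word_value_cons /= gmulfM emb_iota !mulgA.
have := normal_reduced nx.
by rewrite /reduced /alternating /= amalgamatedMl.
Qed.

Hypothesis iota_conj : forall i a b (g : G i),
  iota i a * g = g * iota i b -> a = b.

(** Let v be the value of the word g w. Acting on the empty normal form, a v and
    v a give pairs (a g b, _) and (g c, _) in G_i times the words avoiding i,
    for some b, c in A. These pairs are equal, so a g = g (c b^-1), and
    iota_conj gives a = c b^-1. *)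
Lemma commute_head a i (g : G i) w : reduced (Letter i g :: w) ->
    commute (embA a) (word_value (Letter i g :: w)) ->
  commute (iota i a) g.
Proof.
case/andP=> /=; rewrite alternating_cons /= => /andP[gw w_alt] /andP[gn wn].
(* The letter g meets a word that avoids i, with a prefix c from A. *)
have act_w b : exists c v, avoids i v /\
    val (act (word_value (Letter i g :: w)) (base b)) =
    join_in (g * iota i c, v).
  have := @act_reduced w (base b) wn.
  rewrite [map tag (val (base b)).2]/= cats0 => /(_ w_alt).
  rewrite word_value_cons actM act_emb; case: (val (act (word_value w) _)) => c v.
  rewrite -[(c, v).2]/v => tag_v.
  have av : avoids i v by rewrite /avoids tag_v.
  by exists c, v; rewrite translate_avoids.
have [b [v [av gb]]] := act_w 1; have [c [v' [av' gc]]] := act_w a.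
move=> /(congr1 (fun k => val (act k (base 1)))); rewrite !actM.
have -> : act (embA a) (base 1) = base a.
  by apply: val_inj; rewrite act_embA /= mulg1.
rewrite gc -(emb_iota i) act_emb /= gb.
rewrite /translate join_inK //= => /join_in_inj -/(_ av av')[].
rewrite mulgA => /(canRL (mulgK _)); rewrite -mulgA -gmulfV -gmulfM => ag _.
by rewrite /commute ag -(iota_conj ag).
Qed.

(** Cyclic reduction, by induction on the length of a word for k. *)
Lemma conj_into_factor (i0 : I) p a k : k ^+ p.+1 = embA a ->
  exists i (g : G i), g ^+ p.+1 = iota i a /\ conjugate k (emb i g).
Proof.
have [w ->] := generated k; have [n] := ubnP (size w).
elim: n => // n IHn in w *; rewrite ltnS => w_n wp.
have [[i [g wg]]|[w' [ww' w'_red /andP[]]]] := reduce i0 w.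
  exists i, g; rewrite wg; split=> //; last by exists 1; rewrite conjg1.
  by apply: (@emb_inj i); rewrite gmulfXn emb_iota -wp wg.
rewrite -ww' in wp *.
case: w' => [//|[i g] w'] in ww' w'_red wp *.
case/lastP: w' => [//|w' [j h]] in ww' w'_red wp *.
move=> _ w'_w.
(* First and last letters in distinct factors: the powers of k are reduced. *)
have [ij|ij] := eqVneq i j; last first.
  case/andP: w'_red => w'_alt w'_n; set u := _ :: _ in w'_alt w'_n wp.
  have u_alt s : path (fun i j => i != j) j s ->
      sorted (fun i j => i != j) (map tag u ++ s).
    move: w'_alt; rewrite /alternating /= map_rcons cat_path last_rcons /=.
    by move=> -> ->.
  have pow_alt m : path (fun i j => i != j) j
      (map tag (val (act (word_value u ^+ m) (base 1))).2).
    elim: m => [|m IHm]; first by rewrite act1.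
    rewrite expgS actM act_reduced ?u_alt //.
    by rewrite /= eq_sym ij; apply: u_alt.
  have := act_embA a (base 1); rewrite -wp expgS actM.
  move=> /(congr1 (map tag \o snd)).
  by rewrite /= act_reduced ?u_alt.
(* Otherwise, conjugation by the first letter, which commutes with a, merges
   it with the last one. *)
case: _ / ij in h ww' w'_red wp w'_w *.
set v := word_value _ in ww' wp *.
have ga : commute (iota i a) g.
  by apply: (commute_head w'_red); rewrite -wp /commute -expgSr -expgS.
have vE : v ^ emb i g = word_value (rcons w' (Letter i (h * g))).
  rewrite /v word_value_cons !word_value_rcons /= conjgE gmulfM.
  by rewrite !mulgA mulVg mul1g.
have [||q [s [sp [t vs]]]] := IHn (rcons w' (Letter i (h * g))).
- by apply: leq_trans w_n; apply: leq_trans w'_w; rewrite /= !size_rcons.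
- rewrite -vE -conjXg wp -(emb_iota i) -gmulfJ; congr (emb i _).
  by rewrite conjgE ga mulKg.
exists q, s; split=> //; exists (t * (emb i g)^-1).
by rewrite conjgM -vs -vE conjgK.
Qed.

End Amalgam.
End NormalForms.

(** * Groups of bijections and the universal property *)

(** Universal properties produce group morphisms; with this group as target,
    they produce actions. *)
Section SelfBijections.
Variable X : choiceType.

Definition self_bijection :=
  {f : (X -> X) * (X -> X) | `[<cancel f.1 f.2 /\ cancel f.2 f.1>]}.
HB.instance Definition _ := Choice.on self_bijection.

Implicit Types f g : self_bijection.

Lemma self_bijection_inj f g : (val f).1 = (val g).1 -> f = g.
Proof.
case: f g => -[f f'] /= fP [[g g'] /= gP] fg; apply: val_inj => /=.
case/asboolP: fP => /= fK _; case/asboolP: gP => /= _ gK.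
congr (_, _) => //; apply: funext => x.
by rewrite -{1}(gK x) -fg fK.
Qed.

Definition bij_one : self_bijection :=
  exist _ (id, id) (asboolT (conj (frefl id) (frefl id))).

Lemma bij_mul_subproof f g :
  `[<cancel ((val f).1 \o (val g).1) ((val g).2 \o (val f).2) /\
     cancel ((val g).2 \o (val f).2) ((val f).1 \o (val g).1)>].
Proof.
case/asboolP: (valP f) => f12 f21; case/asboolP: (valP g) => g12 g21.
by apply/asboolP; split; apply: can_comp.
Qed.

Definition bij_mul f g : self_bijection :=
  exist _ (_, _) (bij_mul_subproof f g).

Lemma bij_inv_subproof f :
  `[<cancel (val f).2 (val f).1 /\ cancel (val f).1 (val f).2>].
Proof. by case/asboolP: (valP f) => f12 f21; apply/asboolP. Qed.

Definition bij_inv f : self_bijection := exist _ (_, _) (bij_inv_subproof f).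

Lemma bij_mulA : associative bij_mul.
Proof. by move=> f g k; apply: self_bijection_inj. Qed.

Lemma bij_mul1 : left_id bij_one bij_mul.
Proof. by move=> f; apply: self_bijection_inj. Qed.

Lemma bij_mulr1 : right_id bij_one bij_mul.
Proof. by move=> f; apply: self_bijection_inj. Qed.

Lemma bij_mulV : left_inverse bij_one bij_inv bij_mul.
Proof.
move=> f; apply: self_bijection_inj; apply: funext.
by case/asboolP: (valP f).
Qed.

Lemma bij_mulrV : right_inverse bij_one bij_inv bij_mul.
Proof.
move=> f; apply: self_bijection_inj; apply: funext.
by case/asboolP: (valP f).
Qed.

HB.instance Definition _ := isGroup.Build self_bijection
  bij_mulA bij_mul1 bij_mulr1 bij_mulV bij_mulrV.

Lemma action_morphism (H : groupType) (act : H -> X -> X) :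
  (forall x, act 1 x = x) ->
  (forall (g h : H) x, act (g * h) x = act g (act h x)) ->
  exists F : UMagmaMorphism.type H self_bijection,
    forall g : H, (val (F g)).1 = act g.
Proof.
move=> act1 actM.
have actP (g : H) : `[<cancel (act g) (act g^-1) /\ cancel (act g^-1) (act g)>].
  by apply/asboolP; split=> x; rewrite -actM ?mulVg ?mulgV act1.
pose F (g : H) : self_bijection := exist _ (act g, act g^-1) (actP g).
have FM : {morph F : g h / g * h}.
  by move=> g h; apply: self_bijection_inj; apply: funext => x; apply: actM.
have F1 : F 1 = 1.
  by apply: self_bijection_inj; apply: funext => x; apply: act1.
pose FMm := isMultiplicative.Build _ _ F FM.
pose F1m := Multiplicative_isUMagmaMorphism.Build _ _ F F1.
pose FF : UMagmaMorphism.type H self_bijection := HB.pack F FMm F1m.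
by exists FF.
Qed.

End SelfBijections.

(** The role of iota_conj: an element g of a factor that conjugates a into A
    must commute with a, so that the conjugations made during cyclic reduction
    preserve the equation k ^ p.+1 = a. With g := 1, it makes A embed in the
    factors. *)
Theorem amalgam_root_conjugate (I : choiceType) (A K : groupType)
    (G : I -> groupType) (iota : forall i, UMagmaMorphism.type A (G i))
    (emb : forall i, UMagmaMorphism.type (G i) K)
    (embA : UMagmaMorphism.type A K)
    (emb_iota : forall i a, emb i (iota i a) = embA a)
    (generated : forall k, exists w, k = word_value emb w)
    (universal : forall (H : groupType)
        (f : forall i, UMagmaMorphism.type (G i) H),
      (forall i j a, f i (iota i a) = f j (iota j a)) ->
      exists F : UMagmaMorphism.type K H, forall i g, F (emb i g) = f i g)
    (iota_conj : forall i a b (g : G i), iota i a * g = g * iota i b -> a = b)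
    (i0 : I) (p : nat) (a : A) (k : K) :
  k ^+ p.+1 = embA a ->
  exists i (g : G i), g ^+ p.+1 = iota i a /\ conjugate k (emb i g).
Proof.
have iota_inj i : injective (iota i).
  by move=> b c bc; apply: (@iota_conj i _ _ 1); rewrite mulg1 mul1g.
pose X := normal_form iota.
have actE i : exists f : UMagmaMorphism.type (G i) (self_bijection X),
    forall g, (val (f g)).1 = act_letter (iota := iota) g.
  by apply: action_morphism; [exact: act_letter1|exact: act_letterM].
pose f i := sval (cid (actE i)); pose fE i := svalP (cid (actE i)).
have [|F FE] := universal _ f.
  move=> i j b; apply: self_bijection_inj; rewrite !fE; apply: funext => x.
  exact: act_letter_iota.
have F_emb i (g : G i) x :
    val ((val (F (emb i g))).1 x) = translate iota g (val x).
  by rewrite FE fE.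
apply: (conj_into_factor (act := fun k => (val (F k)).1) (embA := embA)
  emb_iota generated) => //.
- by move=> x; rewrite gmulf1.
- by move=> k' l x; rewrite gmulfM.
- move=> b [[c w] nw]; rewrite -(emb_iota i0) F_emb /=.
  exact: translate_iota.
Qed.

(** * The enveloping group of a Delta-product *)

Lemma mquot_lift (M N : monoidType) (R : M -> M -> Prop)
    (f : UMagmaMorphism.type M N) :
  (forall x y, R x y -> f x = f y) ->
  exists F : UMagmaMorphism.type (mquot R) N,
    forall x, F (mquot_in R x) = f x.
Proof.
move=> fR; pose F (a : mquot R) := f (repr a).
have FE x : F (mquot_in R x) = f x.
  apply: (cong_morph _ fR); first exact: gmulfM.
  by apply/mquot_inP; exact: mquot_reprK.
have FM : {morph F : a b / a * b}.
  by move=> a b; rewrite -(mquot_reprK a) -(mquot_reprK b) -mquot_inM !FE gmulfM.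
have F1 : F 1 = 1 by rewrite -[1]/(mquot_in R 1) FE gmulf1.
pose FMm := isMultiplicative.Build _ _ F FM.
pose F1m := Multiplicative_isUMagmaMorphism.Build _ _ F F1.
by exists (HB.pack F FMm F1m : UMagmaMorphism.type (mquot R) N).
Qed.

Lemma free_lift (X : choiceType) (N : monoidType) (f : X -> N) :
  exists F : UMagmaMorphism.type (freeMonoid X) N,
    forall x, F (letter x) = f x.
Proof.
pose F (w : freeMonoid X) := \prod_(x <- w) f x.
have FM : {morph F : v w / v * w} by move=> v w; apply: big_cat.
have F1 : F 1 = 1 by apply: big_nil.
pose FMm := isMultiplicative.Build _ _ F FM.
pose F1m := Multiplicative_isUMagmaMorphism.Build _ _ F F1.
exists (HB.pack F FMm F1m : UMagmaMorphism.type (freeMonoid X) N) => x.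
exact: big_seq1.
Qed.

Lemma free_ind (X : choiceType) (P : freeMonoid X -> Prop) :
  P 1 -> (forall v w, P v -> P w -> P (v * w)) -> (forall x, P (letter x)) ->
  forall w, P w.
Proof.
move=> P1 PM Pl; elim=> [//|x w Pw].
exact: (PM (letter x) w).
Qed.

Lemma env_ind (M : monoidType) (P : envGroup M -> Prop) :
    P 1 -> (forall a b, P a -> P b -> P (a * b)) ->
    (forall a, P a -> P a^-1) -> (forall x, P (env_in x)) ->
  forall a, P a.
Proof.
move=> P1 PM PV Pin a; rewrite -(mquot_reprK a).
elim/free_ind: (repr a) => [//|v w Pv Pw|[x|x]].
- by rewrite mquot_inM; apply: PM.
- exact: Pin.
suff -> : mquot_in _ (letter (inr x : env_letter M)) = (env_in x)^-1 by apply: PV.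
apply: (mulgI (env_in x)); rewrite mulgV /env_in -mquot_inM.
by apply: mquot_rel; apply: env_mulV.
Qed.

Lemma env_morph_ext (M : monoidType) (H : groupType)
    (f g : UMagmaMorphism.type (envGroup M) H) :
  (forall x, f (env_in x) = g (env_in x)) -> forall a, f a = g a.
Proof.
move=> fg; elim/env_ind => [|a b fa fb|a fa|//]; first by rewrite !gmulf1.
  by rewrite !gmulfM fa fb.
by rewrite !gmulfV fa.
Qed.

Section DeltaProductGroup.
Variables (h : nat) (M : 'I_h -> monoidType) (Delta : forall i, M i).

Lemma deltaProd_ind (P : deltaProd Delta -> Prop) :
    P 1 -> (forall x y, P x -> P y -> P (x * y)) ->
    (forall i (x : M i), P (deltaProd_in Delta x)) ->
  forall x, P x.
Proof.
move=> P1 PM Pin x; rewrite -(mquot_reprK x) -(mquot_reprK (repr x)).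
elim/free_ind: (repr (repr x)) => [//|v w Pv Pw|[i y]]; last exact: Pin.
by rewrite !mquot_inM; apply: PM.
Qed.

Lemma deltaProd_env_generated (k : envGroup (deltaProd Delta)) :
  exists w : seq {i : 'I_h & envGroup (M i)},
    k = word_value (G := fun i => envGroup (M i)) (phi Delta) w.
Proof.
elim/env_ind: k => [|_ _ [v ->] [w ->]|_ [w ->]|x].
- by exists [::]; rewrite /word_value big_nil.
- by exists (v ++ w); rewrite /word_value big_cat.
- elim: w => [|[i g] w [v vw]].
    by exists [::]; rewrite /word_value big_nil invg1.
  exists (rcons v (existT _ i g^-1)).
  by rewrite word_value_rcons -vw word_value_cons invgM /= gmulfV.
elim/deltaProd_ind: x => [|x y [v xv] [w yw]|i x].
- by exists [::]; rewrite /word_value big_nil env_in1.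
- by exists (v ++ w); rewrite env_inM xv yw /word_value big_cat.
exists [:: existT _ i (env_in x)].
by rewrite /word_value big_seq1 /= phiE.
Qed.

(** The presentations are used one after the other: the f i define a morphism on
    the free monoid of letters, which passes to the free product, then to the
    Delta-product, and extends to the enveloping group. *)
Lemma deltaProd_env_universal (H : groupType)
    (f : forall i, UMagmaMorphism.type (envGroup (M i)) H) :
    (forall i j, f i (env_in (Delta i)) = f j (env_in (Delta j))) ->
  exists F : UMagmaMorphism.type (envGroup (deltaProd Delta)) H,
    forall i g, F (phi Delta g) = f i g.
Proof.
move=> fD.
have [F0 F0E] := @free_lift (factors M) H
  (fun u => f (tag u) (env_in (tagged u))).
have [|F1 F1E] := @mquot_lift _ _ (@freeProd_rel h M) F0.
  move=> _ _ [i|i x y]; rewrite ?gmulfM !F0E ?gmulf1 //.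
  by rewrite -!gmulfM.
have [|F2 F2E] := @mquot_lift _ _ (@deltaProd_rel h M Delta) F1.
  by move=> _ _ [i j]; rewrite !F1E !F0E.
exists (env_lift F2) => i.
apply: (env_morph_ext (f := env_lift F2 \o @phi h M Delta i)) => x /=.
by rewrite phiE env_liftE F2E F1E F0E.
Qed.

End DeltaProductGroup.

(** * Powers of Delta and the length *)

Section IntPowers.
Variables (G : groupType) (x : G).

(** The integers as a multiplicative group: the amalgamated subgroup, and the
    group where lengths take their values. *)
Definition Zgroup : groupType := Algebra.to_multiplicative int.

Definition zpow (n : Zgroup) : G := expgz x n.

Lemma expgz_succ (n : int) : expgz x (n + 1)%R = expgz x n * x.
Proof.
case: n => [n|[|n]]; first by rewrite /= addn1 expgSr.
  by rewrite /= mulVg.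
have -> : (Negz n.+1 + 1)%R = Negz n.
  by rewrite !NegzE -[n.+2]addn1 PoszD GRing.opprD GRing.subrK.
by rewrite /= (expgS _ n.+1) invgM mulgVK.
Qed.

Lemma expgz_pred (n : int) : expgz x (n - 1)%R = expgz x n * x^-1.
Proof. by rewrite -{2}(GRing.subrK 1%R n) expgz_succ mulgK. Qed.

Lemma zpowM : {morph zpow : m n / m * n}.
Proof.
move=> m n; rewrite /zpow -[m * n]/(m + n)%R.
elim/int_ind: n => [|n IHn|n IHn]; first by rewrite GRing.addr0 mulg1.
  by rewrite intS (GRing.addrC 1%R) GRing.addrA !expgz_succ IHn mulgA.
rewrite intS GRing.opprD (GRing.addrC (- 1)%R) GRing.addrA !expgz_pred IHn.
by rewrite mulgA.
Qed.

HB.instance Definition _ := isMultiplicative.Build Zgroup G zpow zpowM.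
HB.instance Definition _ :=
  Multiplicative_isUMagmaMorphism.Build Zgroup G zpow erefl.

End IntPowers.

Lemma zpow_int (n m : Zgroup) : zpow n m = (n * m)%R.
Proof.
elim/int_ind: m => [|m IHm|m IHm]; first by rewrite GRing.mulr0.
  rewrite /zpow intS GRing.addrC expgz_succ GRing.mulrDr GRing.mulr1.
  by rewrite -[_ * _]/(_ + _)%R; congr (_ + _)%R.
rewrite /zpow intS GRing.opprD GRing.addrC expgz_pred GRing.mulrDr GRing.mulrN1.
by rewrite -[_ * _]/(_ - _)%R; congr (_ - _)%R.
Qed.

Lemma gmulfz (G H : groupType) (f : UMagmaMorphism.type G H) x n :
  f (expgz x n) = expgz (f x) n.
Proof. by case: n => n; rewrite /= ?gmulfV gmulfXn. Qed.

Section Length.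
Variables (M : monoidType) (l : M -> nat).
Hypothesis l_morphism : nat_morphism l.

Definition int_length (x : M) : Zgroup := Posz (l x).

Lemma int_lengthM : {morph int_length : x y / x * y}.
Proof. by move=> x y; rewrite /int_length l_morphism.2. Qed.

Lemma length_morphism : exists f : UMagmaMorphism.type M Zgroup,
  forall x, f x = Posz (l x).
Proof.
have l1 : int_length 1 = 1 by rewrite /int_length l_morphism.1.
pose fM := isMultiplicative.Build _ _ int_length int_lengthM.
pose f1 := Multiplicative_isUMagmaMorphism.Build _ _ int_length l1.
by exists (HB.pack int_length fM f1 : UMagmaMorphism.type M Zgroup).
Qed.

(** A product of elements of positive length has length zero only if it is
    empty. *)
Lemma length_eq0 : generates [set x | (0 < l x)%N]%classic ->
  forall x, l x = 0%N -> x = 1.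
Proof.
move=> gen x; have [[|y s] s_pos ->] := gen x; first by rewrite big_nil.
rewrite big_cons l_morphism.2 => /eqP; rewrite addn_eq0 => /andP[/eqP y0 _].
by have := s_pos y (mem_head y s); rewrite /= y0.
Qed.

(** The length extends to the enveloping group, where it takes distinct values
    at distinct powers of d and is invariant under conjugation. *)
Lemma zpow_conj (d : M) : (0 < l d)%N ->
  forall (m n : Zgroup) (g : envGroup M),
  zpow (env_in d) m * g = g * zpow (env_in d) n -> m = n.
Proof.
have [f fE] := length_morphism.
have fz n : env_lift f (zpow (env_in d) n) = (Posz (l d) * n)%R.
  by rewrite -zpow_int -fE -(env_liftE f); exact: gmulfz.
move=> d_pos m n g /(congr1 (env_lift f)); rewrite !env_liftM !fz.
rewrite -[LHS]/(_ + _)%R -[RHS]/(_ + _)%R [RHS]GRing.addrC => /GRing.addIr.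
by apply: GRing.mulfI; rewrite -lt0n.
Qed.

End Length.

(** * Periodic elements *)

Theorem proposition3p11 (h : nat) (h_gt0 : (0 < h)%N)
    (M : 'I_h -> monoidType) (Delta : forall i : 'I_h, M i)
    (HG : forall i : 'I_h, homogeneous_garside (Delta i))
    (Hdist : forall i : 'I_h, ~ M11 (Delta i))
    (Hnontriv : forall i j : 'I_h, Delta i = 1%g -> Delta j = 1%g)
    (p q : int) (p_neq0 : p <> 0%Z) (q_neq0 : q <> 0%Z)
    (rho : envGroup (deltaProd Delta))
    (Hrho : periodic (deltaProd_Delta Delta h_gt0) p q rho) :
  exists (i : 'I_h) (sigma : envGroup (M i)),
    periodic (Delta i) p q sigma /\ conjugate rho (phi Delta sigma).
Proof.
pose i0 := Ordinal h_gt0.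
have len i : exists l : M i -> nat,
    nat_morphism l /\ forall x, l x = 0%N -> x = 1.
  have [[l l_morph /(length_eq0 l_morph) l0] _ _ _ _ _ _] := HG i.
  by exists l.
(* If Delta is 1, then so are all its divisors, and everything is trivial. *)
have [D1|D1] := pselect (Delta i0 = 1).
  have M1 i (x : M i) : x = 1.
    have [l [l_morph l0]] := len i.
    have [_ _ _ _ _ _ /(_ x)[s s_div ->]] := HG i.
    rewrite big_seq; apply: big1 => y /s_div /=; rewrite (Hnontriv _ i D1).
    case=> z /(congr1 l); rewrite l_morph.1 l_morph.2 => /esym/eqP.
    by rewrite addn_eq0 => /andP[/eqP /l0].
  have env1 i (g : envGroup (M i)) : g = 1.
    elim/env_ind: g => [//|_ _ -> ->|_ ->|x]; rewrite ?mulg1 ?invg1 //.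
    by rewrite (M1 i x) gmulf1.
  have expgz1 (G : groupType) n : expgz (1 : G) n = 1.
    by case: n => n; rewrite /= ?invg1 expg1n ?invg1.
  exists i0, 1; split; first by rewrite /periodic (env1 _ (env_in _)) !expgz1.
  exists 1; rewrite conjg1 gmulf1.
  have [w ->] := deltaProd_env_generated rho.
  by apply: big1 => -[i g] _; rewrite (env1 i g) gmulf1.
have iota_conj i (a b : Zgroup) (g : envGroup (M i)) :
    zpow (env_in (Delta i)) a * g = g * zpow (env_in (Delta i)) b -> a = b.
  have [l [l_morph l0]] := len i; apply: (zpow_conj l_morph).
  by rewrite lt0n; apply/eqP => /l0 /(Hnontriv i i0).
have emb_iota i a : phi Delta (zpow (env_in (Delta i)) a) =
    zpow (env_in (deltaProd_Delta Delta h_gt0)) a.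
  by rewrite -(deltaProd_DeltaE Delta h_gt0 i) -phiE; exact: gmulfz.
have root n a : rho ^+ n.+1 = zpow (env_in (deltaProd_Delta Delta h_gt0)) a ->
    exists i (g : envGroup (M i)),
      g ^+ n.+1 = zpow (env_in (Delta i)) a /\ conjugate rho (phi Delta g).
  apply: (amalgam_root_conjugate (G := fun i => envGroup (M i))
    (iota := fun i => zpow (env_in (Delta i))) emb_iota _ _ iota_conj i0).
  - exact: deltaProd_env_generated.
  move=> H f fD; apply: deltaProd_env_universal => i j.
  exact: fD i j (1%R : int).
case: p Hrho p_neq0 => [[//|n]|n]; rewrite /periodic /= => Hrho _.
  exact: root Hrho.
(* A negative exponent: take the root of the inverse power of Delta. *)
have [|i [g [gn rho_g]]] := root n (q : Zgroup)^-1.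
  by rewrite gmulfV -[_ q]Hrho invgK.
by exists i, g; split=> //; rewrite gn gmulfV invgK.
Qed.
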